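(* Fix $\Delta>0$ and let $q=1-e^{-\lambda\Delta}$. In the $\mathrm{EDD}(\lambda)$ model with a global clock, the probability that a run of the protocol $\mathrm{CORE}(\Delta)$ is correct equals $\sum_{k=0}^{n}\frac{1}{k!}\,q^{\,n-k}(1-q)^k$.
   Context: Agents $i_0,i_1,\ldots,i_n$ share an accurate global clock and are connected by a complete reliable network; the delay of each message is an independent exponential random variable with parameter $\lambda$. At time $0$ the supervisor $i_0$ receives an external input. Protocol $\mathrm{CORE}(\Delta)$: at time $0$, $i_0$ sends a ''trigger'' message to each of $i_1,\ldots,i_n$ (with independent delays $e_1,\ldots,e_n$); upon receiving the trigger, agent $i_k$ waits until the global time is at least $\Delta$ and then performs its action $\alpha_k$ (so if the trigger arrives after time $\Delta$ it acts immediately on arrival). Letting $t_k$ be the time at which $i_k$ performs $\alpha_k$, a run is correct if $t_1\le t_2\le\cdots\le t_n<\infty$. *)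

(* Defs.v *)
From HB Require Import structures.
From mathcomp Require Import all_boot all_order all_algebra.
From mathcomp Require Import all_classical all_reals all_analysis.
Set Implicit Arguments. Unset Strict Implicit. Unset Printing Implicit Defensive.
Import Order.TTheory GRing.Theory Num.Theory.
Local Open Scope classical_set_scope.
Local Open Scope ring_scope.

(* Mutual independence of a finite family of real random variables:
   the product rule for preimages of arbitrary Borel sets
   (taking B i = setT recovers every subfamily). *)
Definition mutually_independent d (T : measurableType d) (R : realType)
  (P : probability T R) (n : nat) (X : 'I_n -> {RV P >-> R}) : Prop :=
  forall B : 'I_n -> set R, (forall i, measurable (B i)) ->
    P (\bigcap_(i in [set: 'I_n]) (X i @^-1` B i)) =
    (\prod_(i < n) P (X i @^-1` B i))%E.

Definition exponentially_distributed d (T : measurableType d) (R : realType)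
  (P : probability T R) (lam : R) (X : {RV P >-> R}) : Prop :=
  forall A : set R, measurable A -> distribution P X A = exponential_prob lam A.

(* CORE(Delta): agent i_k receives the trigger at time e_k and acts at the
   first time >= Delta not before arrival, i.e. at max(Delta, e_k). *)
Definition core_action_time (R : realType) (Delta e : R) : R := Num.max Delta e.

(* A run (given the delays e_1..e_n, indexed by 'I_n, index i <-> agent i+1)
   is correct iff t_1 <= t_2 <= ... <= t_n (all t_k are finite reals). *)
Definition core_correct (R : realType) (n : nat) (Delta : R) (e : 'I_n -> R) : Prop :=
  forall i j : 'I_n, (i <= j)%N ->
    core_action_time Delta (e i) <= core_action_time Delta (e j).

(* Main.v *)
(* The variables V_i = 1 - exp(-lam e_i) satisfy P(V_i <= v) = v on [q, 1], and
   a run is correct iff max(q, V_1) <= ... <= max(q, V_n).  Let F_m(v) be the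
   probability that the first m of these are in order and at most v.  For
   q <= x <= y <= 1, independence of V_{m+1} gives
     F_m(x) (y - x) <= F_{m+1}(y) - F_{m+1}(x) <= F_m(y) (y - x),
   because the increment is the probability that moreover x < V_{m+1} <= y.
   With F_m(q) = q^m this determines F_m(v) = sum_k q^(m-k) (v - q)^k / k!, and
   v = 1 is the claim.  Only the product rule on boxes is used for
   independence: the events carry arbitrary Borel constraints on the later
   variables through the induction, so no joint law is needed. *)
Require Import Defs.
From HB Require Import structures.
From mathcomp Require Import all_boot all_order all_algebra.
From mathcomp Require Import all_classical all_reals all_analysis.
From mathcomp Require Import measurable_realfun.
From mathcomp Require Import ring lra.
Import Order.TTheory GRing.Theory Num.Theory.
Local Open Scope classical_set_scope.
Local Open Scope ring_scope.

(** * Uniqueness of a function with squeezed increments *)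

(* On a partition of [a, b] into N equal parts f - g moves by at most
   (h b - h a) (b - a) / N; h need not be continuous. *)
Lemma eq_of_squeezed_increments (R : realType) (a b : R) (f g h : R -> R) :
  a <= b -> f a = g a ->
  (forall x y, a <= x -> x <= y -> y <= b ->
     h x * (y - x) <= f y - f x <= h y * (y - x)) ->
  (forall x y, a <= x -> x <= y -> y <= b ->
     h x * (y - x) <= g y - g x <= h y * (y - x)) ->
  f b = g b.
Proof.
move=> ab fga hf hg.
pose D x := f x - g x.
have key N : N.+1%:R * `|D b| <= (h b - h a) * (b - a).
  have N0 : (0 : R) < N.+1%:R by rewrite ltr0n.
  pose s := (b - a) / N.+1%:R.
  have s0 : 0 <= s by rewrite divr_ge0 ?subr_ge0 // ltW.
  have Ns : N.+1%:R * s = b - a by rewrite /s mulrC divfK // gt_eqF.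
  have step j : (j <= N.+1)%N ->
      `|D (a + j%:R * s)| <= (h (a + j%:R * s) - h a) * s.
    elim: j => [_|j IH jN].
      by rewrite mul0r addr0 subrr mul0r /D fga subrr normr0.
    have {}IH := IH (ltnW jN).
    set x := a + j%:R * s in IH *.
    have yE : a + j.+1%:R * s = x + s.
      by rewrite /x -natr1 mulrDl mul1r addrA.
    rewrite yE.
    have ax : a <= x by rewrite lerDl mulr_ge0.
    have xy : x <= x + s by rewrite lerDl.
    have yb : x + s <= b.
      rewrite -yE -lerBrDl -Ns ler_wpM2r // ler_nat //.
    (* Both increments over the piece lie between [h x * s] and [h (x + s) * s], so [D] moves by at
       most the difference; these bounds telescope. *)
    have := hf _ _ ax xy yb; have := hg _ _ ax xy yb.
    have -> : x + s - x = s by ring.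
    move=> /andP[g1 g2] /andP[f1 f2].
    move: IH; rewrite /D !ler_norml => /andP[d1 d2].
    by apply/andP; split; lra.
  have := step N.+1 (leqnn _); rewrite Ns addrC subrK => le_s.
  apply: le_trans (ler_wpM2l (ltW N0) le_s) _.
  by rewrite mulrCA Ns.
suff : D b = 0 by move/eqP; rewrite subr_eq0 => /eqP.
(* If [D b] were nonzero, an [N] beyond [(h b - h a) * (b - a) / |D b|] would contradict [key]. *)
apply/eqP; rewrite -normr_eq0 eq_le normr_ge0 andbT leNgt; apply/negP => Db.
have c0 : 0 <= (h b - h a) * (b - a).
  by apply: le_trans (key 0%N); rewrite mul1r normr_ge0.
have := archi_boundP (divr_ge0 c0 (ltW Db)).
rewrite ltr_pdivrMr //; set N := Num.bound _ => lt1.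
suff /(lt_le_trans lt1) : N%:R * `|D b| <= (h b - h a) * (b - a) by rewrite ltxx.
by apply: le_trans (key N); rewrite ler_wpM2r ?ler_nat // ltW.
Qed.

(** * The polynomials F_m *)

(** Expanding in powers of [v - q] makes each polynomial the derivative in [v] of the next one and
    leaves only the term [k = 0] at [v = q]. *)
Definition core_poly {R : realType} (q : R) (m : nat) (v : R) : R :=
  \sum_(k < m.+1) (k`!%:R)^-1 * q ^+ (m - k) * (v - q) ^+ k.

Lemma core_poly_q (R : realType) (q : R) m : core_poly q m q = q ^+ m.
Proof.
rewrite /core_poly big_ord_recl /= subn0 subrr expr0 fact0 invr1 mul1r mulr1.
by rewrite big1 ?addr0 // => k _; rewrite /= expr0n mulr0.
Qed.

(** A mean value bound: [core_poly q m] is the derivative of [core_poly q m.+1] and is nondecreasing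
    from [q] on. It is obtained term by term, without calculus. *)
Lemma core_poly_increment (R : realType) (q : R) m x y :
  0 <= q -> q <= x -> x <= y ->
  core_poly q m x * (y - x) <= core_poly q m.+1 y - core_poly q m.+1 x
    <= core_poly q m y * (y - x).
Proof.
move=> q0 qx xy.
have invfE k : (k`!%:R)^-1 = (k.+1`!%:R)^-1 * k.+1%:R :> R.
  by rewrite factS natrM invfM mulrAC mulVf ?mul1r // pnatr_eq0.
(* The difference of powers is [t - s] times a sum of [k.+1] monomials of degree [k] in [s] and [t],
   each between [s ^+ k] and [t ^+ k]. *)
have powers k (s t : R) : 0 <= s -> s <= t ->
    s ^+ k * (t - s) *+ k.+1 <= t ^+ k.+1 - s ^+ k.+1 <= t ^+ k * (t - s) *+ k.+1.
  move=> s0 st; have t0 := le_trans s0 st.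
  have ts : 0 <= t - s by rewrite subr_ge0.
  have powE (z : R) (i : 'I_k.+1) : z ^+ k = z ^+ (k - i) * z ^+ i.
    by rewrite -exprD subnK // -ltnS.
  rewrite subrXX -!mulrnAl ![_ * (t - s)]mulrC.
  apply/andP; split; apply: ler_wpM2l => //=.
    rewrite -[k.+1 in X in X <= _](card_ord k.+1) -sumr_const ler_sum // => i _.
    rewrite (powE s i).
    by rewrite ler_wpM2r ?exprn_ge0 // lerXn2r.
  rewrite -[k.+1 in X in _ <= X](card_ord k.+1) -sumr_const ler_sum // => i _.
  rewrite (powE t i).
  by rewrite ler_wpM2l ?exprn_ge0 // lerXn2r.
(* The constant terms cancel, so term [k.+1] of the increment faces term [k] of the bounds. *)
rewrite /core_poly !(big_ord_recl m.+1) /= !expr0 opprD addrACA subrr add0r.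
rewrite -sumrB !mulr_suml; apply/andP; split; apply: ler_sum => k _;
  rewrite /= /bump leq0n add1n subSS -mulrBr;
  have [] := andP (powers k (x - q) (y - q) _ _); rewrite ?subr_ge0 ?lerD2r //;
  rewrite (_ : y - q - (x - q) = y - x); try ring; move=> lo hi;
  have c0 : 0 <= (k.+1`!%:R)^-1 * q ^+ (m - k) :> R;
  try by rewrite mulr_ge0 ?invr_ge0 ?exprn_ge0.
- apply: le_trans (ler_wpM2l c0 lo); rewrite (invfE k) -mulr_natr le_eqVlt.
  by apply/orP; left; apply/eqP; ring.
- apply: le_trans (ler_wpM2l c0 hi) _; rewrite (invfE k) -mulr_natr le_eqVlt.
  by apply/orP; left; apply/eqP; ring.
Qed.

(** * Events of an ordered prefix and their probabilities *)

Lemma measurable_imply_set d (T : measurableType d) (b : bool) (A : set T) :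
  measurable A -> measurable [set w | b -> A w].
Proof.
move=> mA; case: b.
  rewrite (_ : [set _ | _] = A) //; apply/seteqP; split => w /=; first exact.
  by [].
by rewrite (_ : [set _ | _] = setT) //; apply/seteqP; split.
Qed.

(** For [m = 0] this is a product event; for [m = n], [v = 1] and the [V] of the theorem it is
    correctness of the run. *)
Definition sorted_prefix {T : Type} {R : realType} {n : nat}
    (V : 'I_n -> T -> R) (q : R) (m : nat) (v : R) (B : 'I_n -> set R) : set T :=
  [set w | [/\ forall i : 'I_n, (i < m)%N -> V i w <= v,
    forall i j : 'I_n, (i <= j)%N -> (j < m)%N ->
      Num.max q (V i w) <= Num.max q (V j w) &
    forall i : 'I_n, (m <= i)%N -> B i (V i w)]].

Lemma measurable_sorted_prefix d (T : measurableType d) (R : realType) n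
    (V : 'I_n -> T -> R) q m v B :
  (forall i, measurable_fun setT (V i)) -> (forall i, measurable (B i)) ->
  measurable (sorted_prefix V q m v B).
Proof.
move=> mV mB.
have mle (f g : T -> R) : measurable_fun setT f -> measurable_fun setT g ->
    measurable [set w | f w <= g w].
  move=> mf mg; rewrite -[X in measurable X]setTI.
  exact: (measurable_fun_ler mf mg measurableT (Y := [set true])).
have mmax i : measurable_fun setT (fun w => Num.max q (V i w)).
  exact: measurable_maxr.
rewrite (_ : sorted_prefix _ _ _ _ _ =
  \bigcap_(i in [set: 'I_n]) [set w | (i < m)%N -> V i w <= v] `&`
  \bigcap_(i in [set: 'I_n]) \bigcap_(j in [set: 'I_n])
    [set w | (i <= j)%N && (j < m)%N -> Num.max q (V i w) <= Num.max q (V j w)] `&`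
  \bigcap_(i in [set: 'I_n]) [set w | (m <= i)%N -> B i (V i w)]).
  apply: measurableI; first apply: measurableI.
  - apply: fin_bigcap_measurable => [|i _]; first exact: finite_finset.
    by apply: measurable_imply_set; apply: mle.
  - apply: fin_bigcap_measurable => [|i _]; first exact: finite_finset.
    apply: fin_bigcap_measurable => [|j _]; first exact: finite_finset.
    by apply: measurable_imply_set; apply: mle.
  - apply: fin_bigcap_measurable => [|i _]; first exact: finite_finset.
    by apply: measurable_imply_set; rewrite -[X in measurable X]setTI; exact: mV.
apply/seteqP; split => w /=.
  move=> [h1 h2 h3]; split; first split => i _ /=; first exact: h1.
    by move=> j _ /= /andP[]; exact: h2.
  by move=> i _; exact: h3.
move=> [[h1 h2] h3]; split=> [i|i j ij jm|i]; [exact: h1| |exact: h3].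
by apply: (h2 i _ j) => //; rewrite ij.
Qed.

(** Induction on [m] for all [B] at once: a condition on the variable of index [m] is moved into
    [B], where the induction hypothesis for prefix length [m] applies. *)
Lemma sorted_prefix_probability d (T : measurableType d) (R : realType)
    (P : probability T R) n (V : 'I_n -> T -> R) (q : R) :
  0 <= q <= 1 ->
  (forall i, measurable_fun setT (V i)) ->
  (forall B : 'I_n -> set R, (forall i, measurable (B i)) ->
    fine (P (\bigcap_(i in [set: 'I_n]) (V i @^-1` B i))) =
    \prod_(i < n) fine (P (V i @^-1` B i))) ->
  (forall i v, q <= v <= 1 -> fine (P [set w | V i w <= v]) = v) ->
  forall m, (m <= n)%N ->
  forall B : 'I_n -> set R, (forall i, measurable (B i)) ->
  forall v, q <= v <= 1 ->
  fine (P (sorted_prefix V q m v B)) =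
  core_poly q m v * \prod_(i < n | (m <= i)%N) fine (P (V i @^-1` B i)).
Proof.
move=> /andP[q0 q1] mV indV cdfV.
have pr_fin A : measurable A -> P A \is a fin_num by exact: fin_num_measure.
have pr_le A B : measurable A -> measurable B -> A `<=` B ->
    fine (P A) <= fine (P B).
  by move=> mA mB AB; rewrite fine_le ?pr_fin // le_measure ?inE.
have pr_D A B : measurable A -> measurable B -> B `<=` A ->
    fine (P (A `\` B)) = fine (P A) - fine (P B).
  move=> mA mB BA; rewrite measureD //; last by rewrite ltey_eq pr_fin.
  by rewrite setIidr // fineB ?pr_fin.
have mVle i v : measurable [set w | V i w <= v].
  rewrite -[X in measurable X]setTI.
  exact: (measurable_fun_ler (mV i) (measurable_cst v) measurableT
    (Y := [set true])).
elim=> [|m IH] mn B mB v /andP[qv v1].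
  rewrite /core_poly big_ord1 /= !expr0 fact0 invr1 !mul1r -indV //.
  congr (fine (P _)); apply/seteqP; split => w /=.
    by move=> [_ _ h] i _; exact: h.
  by move=> h; split=> // i _; exact: h.
pose im : 'I_n := Ordinal mn.
pose upd X i := if i == im then X else B i.
have mupd X : measurable X -> forall i, measurable (upd X i).
  by move=> mX i; rewrite /upd; case: ifP.
have im_case (i : 'I_n) : (i < m.+1)%N -> (i < m)%N \/ i = im.
  rewrite ltnS leq_eqVlt => /orP[/eqP e|]; [right|by left].
  exact: val_inj.
set C := \prod_(i < n | _) _.
have prod_upd X : \prod_(i < n | (m <= i)%N) fine (P (V i @^-1` upd X i)) =
    fine (P (V im @^-1` X)) * C.
  rewrite (bigD1 im) //= {1}/upd eqxx; congr (_ * _).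
  apply: eq_big => [i|i /andP[_ /negPf]]; last by rewrite /upd => ->.
  by rewrite ltn_neqAle andbC -val_eqE /= eq_sym.
have mA x : measurable (sorted_prefix V q m.+1 x B).
  exact: measurable_sorted_prefix.
have [mle_q mitv] : measurable [set z : R | z <= q] /\
    forall x y : R, measurable [set z : R | x < z <= y].
  split=> [|x y]; last by rewrite -set_itvoc.
  by rewrite -set_itvNyc.
have C0 : 0 <= C by apply: prodr_ge0 => i _; rewrite fine_ge0.
pose phi x := fine (P (sorted_prefix V q m.+1 x B)).
apply: (@eq_of_squeezed_increments R q v phi (fun x => core_poly q m.+1 x * C)
  (fun x => core_poly q m x * C)) => //.
(* When all values are at most [q], every maximum equals [q] and the order is automatic; only the
   bound on the variable [im] is added. *)
- have -> : phi q = fine (P (sorted_prefix V q m q (upd [set z | z <= q]))).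
    congr (fine (P _)); apply/seteqP; split => w [h1 h2 h3].
      split=> [i im1|i j ij jm|i mi].
      + exact/h1/leqW.
      + by apply: h2 => //; exact: leqW.
      + rewrite /upd; case: eqP => [->|/eqP ne]; first exact: h1.
        by apply: h3; rewrite ltn_neqAle mi andbT eq_sym.
    have hq (i : 'I_n) : (i < m.+1)%N -> V i w <= q.
      move=> /im_case[/h1 //|->].
      by have := h3 im (leqnn _); rewrite /upd eqxx.
    split=> [||i mi]; first exact: hq.
      move=> i j ij jm.
      by rewrite !max_l // hq // (leq_ltn_trans ij).
    have := h3 i (ltnW mi); rewrite /upd; case: eqP => // iE.
    by move: mi; rewrite iE ltnn.
  rewrite IH ?(ltnW mn) // ?lexx //; last exact: mupd.
  rewrite prod_upd !core_poly_q cdfV ?lexx // exprSr; ring.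
- move=> x y qx xy yv; have y1 := le_trans yv v1.
  have qy := le_trans qx xy; have x1 := le_trans xy y1.
  have sub : sorted_prefix V q m.+1 x B `<=` sorted_prefix V q m.+1 y B.
    by move=> w [h1 h2 h3]; split=> // i /h1 /le_trans; exact.
  (* The factor [y - x] is the probability that variable [im] falls in []x, y]]; [z = x] gives the
     lower bound and [z = y] the upper one. *)
  have IHitv z : q <= z <= 1 -> core_poly q m z * C * (y - x) =
      fine (P (sorted_prefix V q m z (upd [set z | x < z <= y]))).
    move=> hz; rewrite IH ?(ltnW mn) //; last exact: mupd.
    rewrite prod_upd (_ : V im @^-1` _ =
      [set w | V im w <= y] `\` [set w | V im w <= x]); last first.
      apply/seteqP; split => w /=.
        by move=> /andP[xV ->]; split=> //; rewrite leNgt xV.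
      by move=> [-> /negP]; rewrite -ltNge andbT.
    rewrite pr_D ?cdfV ?qx ?qy //; first ring.
    by move=> w /= /le_trans; exact.
  rewrite !IHitv ?qx ?qy // -pr_D //.
  apply/andP; split; apply: pr_le => //; try exact: measurableD;
    try by apply: measurable_sorted_prefix => //; exact: mupd.
  (* Earlier values are at most [x], and variable [im] exceeds [x]: it comes last in order and
     violates the bound [x]. *)
  + move=> w [h1 h2 h3].
    have := h3 im (leqnn _); rewrite /upd eqxx /= => /andP[xV Vy].
    split; last by case=> /(_ im (leqnn _)); rewrite leNgt xV.
    split=> [i /im_case[/h1 /le_trans|->] //|i j ij|i mi]; first exact.
      move=> /im_case[/h2|jE]; first exact.
      subst j; move: ij; rewrite -ltnS => /im_case[ilt|->] //.
      rewrite [leRHS]max_r ?(le_trans qx) ?(ltW xV) //.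
      by rewrite ge_max (le_trans qx) ?(ltW xV) // (le_trans (h1 _ ilt)) ?(ltW xV).
    have := h3 i (ltnW mi); rewrite /upd; case: eqP => // iE.
    by move: mi; rewrite iE ltnn.
  + move=> w [[h1 h2 h3] nx].
    split=> [i im1|i j ij jm|i mi].
    * exact/h1/leqW.
    * by apply: h2 => //; exact: leqW.
    * rewrite /upd; case: eqP => [->|/eqP ne]; last first.
        by apply: h3; rewrite ltn_neqAle mi andbT eq_sym.
      (* If variable [im] were at most [x], the order would force all earlier ones below [x] too,
         against [nx]. *)
      rewrite /= h1 // andbT ltNge; apply/negP => Vx; apply: nx; split=> // k klt.
      have := h2 k im klt (leqnn _); rewrite ge_max => /andP[_].
      by move=> /le_trans; apply; rewrite ge_max qx.
- move=> x y qx xy yv.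
  have /andP[lo hi] := core_poly_increment _ q m _ _ q0 qx xy.
  by rewrite -mulrBl ![_ * C * _]mulrAC !ler_wpM2r.
Qed.

(** * Exponential delays and the correctness probability *)

(** The half-line splits at 0: the density vanishes on the negative part, and the mass of [[0, x]]
    is explicit. *)
Lemma exponential_cdf d (T : measurableType d) (R : realType)
    (P : probability T R) (lam : R) (X : {RV P >-> R}) (x : R) :
  0 < lam -> 0 < x -> exponentially_distributed lam X ->
  P [set w | X w <= x] = (1 - expR (- lam * x))%:E.
Proof.
move=> lam0 x0 hX.
have -> : [set w | X w <= x] = X @^-1` `]-oo, 0[ `|` X @^-1` `[0, x].
  apply/seteqP; split => w /=; rewrite !in_itv /=.
    by move=> ->; rewrite andbT; have [] := ltP (X w) 0; [left|right].
  by case=> [/ltW/le_trans|/andP[] //]; apply; exact: ltW.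
have mX (A : set R) : measurable A -> measurable (X @^-1` A).
  by move=> mA; rewrite -[X in measurable X]setTI; exact: measurable_funPT.
have hP (A : set R) : measurable A -> P (X @^-1` A) = exponential_prob lam A.
  exact: hX.
transitivity (exponential_prob lam `]-oo, 0%R[ + exponential_prob lam `[0%R, x])%E.
  rewrite -!hP // -measureU //; [exact: mX|exact: mX|].
  apply/seteqP; split => w //=; rewrite !in_itv /= => -[X0 /andP[X0' _]].
  by move: X0; rewrite ltNge X0'.
rewrite exponential_prob_itv0c // /exponential_prob integral0_eq.
  by rewrite add0e.
by move=> y /=; rewrite in_itv /= => y0; rewrite lt0_exponential_pdf.
Qed.

Theorem theorem2 (d : measure_display) (T : measurableType d) (R : realType)
  (P : probability T R) (n : nat) (lam Delta : R)
  (e : 'I_n -> {RV P >-> R}) :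
  0 < lam -> 0 < Delta ->
  mutually_independent e ->
  (forall i, exponentially_distributed lam (e i)) ->
  let q := 1 - expR (- lam * Delta) in
  P [set w | core_correct Delta (fun i => e i w)] =
  (\sum_(k < n.+1) (k`!%:R)^-1 * q ^+ (n - k) * (1 - q) ^+ k)%:E.
Proof.
move=> lam0 Delta0 indep exp_e q.
(* [g] is strictly increasing, commutes with maxima and sends [Delta] to [q], so it turns the order
   of action times into that of [Num.max q (V i w)]. *)
pose g (x : R) : R := 1 - expR (- lam * x).
have g_mono : {mono g : x y / x <= y}.
  by move=> x y; rewrite /g lerD2l lerN2 ler_expR !mulNr lerN2 ler_pM2l.
have g_max x y : g (Num.max x y) = Num.max (g x) (g y).
  have [xy|yx] := lerP x y; first by rewrite max_r ?g_mono.
  by rewrite max_l ?g_mono ?ltW.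
have mg : measurable_fun setT g.
  apply: measurable_funB => //; exact: measurableT_comp.
pose V (i : 'I_n) (w : T) := g (e i w).
have mV i : measurable_fun setT (V i) by apply: measurableT_comp.
have mgB (B : set R) : measurable B -> measurable (g @^-1` B).
  by move=> mB; rewrite -[X in measurable X]setTI; exact: mg.
have q01 : 0 <= q <= 1.
  apply/andP; split; last by rewrite gerBl expR_ge0.
  by rewrite subr_ge0 -expR0 ler_expR mulNr oppr_le0 mulr_ge0 // ltW.
have indV (B : 'I_n -> set R) : (forall i, measurable (B i)) ->
    fine (P (\bigcap_(i in [set: 'I_n]) (V i @^-1` B i))) =
    \prod_(i < n) fine (P (V i @^-1` B i)).
  move=> mB; rewrite (indep (fun i => g @^-1` B i)) => [|i]; last exact: mgB.
  rewrite -[RHS]/(fine (_%:E)) -prodEFin; congr fine; apply: eq_bigr => i _.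
  rewrite fineK // fin_num_measure // -[X in measurable X]setTI.
  exact: mV.
have cdfV i v : q <= v <= 1 -> fine (P [set w | V i w <= v]) = v.
  (* The value 1 is treated apart, since [g] stays below it; any smaller [v] has the preimage [x]
     under [g], and [q <= v] gives [Delta <= x]. *)
  move=> /andP[qv]; rewrite le_eqVlt => /orP[/eqP ->|v1].
    rewrite (_ : [set w | _] = setT) ?probability_setT //.
    by apply/seteqP; split => w //= _; rewrite /V /g gerBl expR_ge0.
  have v1' : 0 < 1 - v by rewrite subr_gt0.
  pose x := - ln (1 - v) / lam.
  have gx : g x = v.
    rewrite /g /x mulNr mulrC divfK ?gt_eqF // opprK lnK ?posrE //; ring.
  have x0 : 0 < x.
    by apply: lt_le_trans Delta0 _; rewrite -g_mono gx.
  rewrite (_ : [set w | _] = [set w | e i w <= x]).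
    by rewrite (exponential_cdf _ _ _ _ _ _ _ lam0 x0 (exp_e i)).
  by apply/seteqP; split => w /=; rewrite /V -{1}gx g_mono.
have -> : [set w | core_correct Delta (fun i => e i w)] =
    sorted_prefix V q n 1 (fun=> setT).
  apply/seteqP; split => w; rewrite /core_correct /core_action_time.
    move=> h; split=> // [i _|i j ij _]; first by rewrite /V /g gerBl expR_ge0.
    by rewrite /V -!g_max g_mono h.
  by move=> [_ h _] i j ij; rewrite -g_mono !g_max h.
have q1 : q <= 1 <= (1 : R) by apply/andP; split=> //; case/andP: q01.
rewrite -[LHS]fineK; last first.
  by apply: fin_num_measure; apply: measurable_sorted_prefix.
rewrite (sorted_prefix_probability _ _ _ _ _ _ _ q01 mV indV cdfV) // big_pred0.
  by rewrite mulr1.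
by move=> i; rewrite leqNgt ltn_ord.
Qed.
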